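(* Let $\lambda\ge1$ be an integer. Given a single randomized pass over a stream of the edges of an $n$-vertex graph $G$, succeeding with probability at least $2/3$ at either of the following tasks requires $\Omega(n^2/\lambda^2)$ bits of space: (i) produce a proper $(\kappa+\lambda)$-coloring of $G$; (ii) produce an estimate $\hat\kappa$ with $|\hat\kappa-\kappa|\le\lambda$, where $\kappa=\kappa(G)$. Furthermore, if we require $\lambda=O(\kappa^{1/2-\gamma})$ for some constant $\gamma>0$, then neither task admits a semi-streaming algorithm (one using $\widetilde{O}(n)$ bits of space).
   Context: $\kappa(G)$ is the degeneracy of $G$: the least $k$ such that every induced subgraph has a vertex of degree at most $k$. The stream is a listing of the edges of $G$ in arbitrary order (insertion-only). $\widetilde{O}$ hides polylogarithmic factors in $n$. *)

(* Defs.v *)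
From HB Require Import structures.
From mathcomp Require Import all_boot all_order all_algebra.
From mathcomp Require Import all_classical all_reals all_analysis.

Set Implicit Arguments.
Unset Strict Implicit.
Unset Printing Implicit Defensive.

Import Order.TTheory GRing.Theory Num.Theory.
Local Open Scope classical_set_scope.
Local Open Scope ring_scope.

Record sgraph (n : nat) := SGraph {
  adj : rel 'I_n;
  adj_sym : symmetric adj;
  adj_irrefl : irreflexive adj
}.

Definition edges n (G : sgraph n) : {set {set 'I_n}} :=
  [set [set p.1; p.2]%SET | p in [set p : 'I_n * 'I_n | adj G p.1 p.2]%SET]%SET.

Definition subdeg n (G : sgraph n) (U : {set 'I_n}) (v : 'I_n) : nat :=
  #|[set w in U | adj G v w]%SET|.

Definition degenerate n (G : sgraph n) (k : nat) : bool :=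
  [forall U : {set 'I_n},
     (U != finset.set0) ==> [exists v in U, (subdeg G U v <= k)%N]].

Lemma degenerate_exists n (G : sgraph n) : exists k, degenerate G k.
Proof.
exists n; apply/forallP => U; apply/implyP => /set0Pn[v vU].
apply/existsP; exists v; rewrite vU /=.
by rewrite -[leqRHS]card_ord; exact: max_card.
Qed.

Definition degeneracy n (G : sgraph n) : nat := ex_minn (degenerate_exists G).

Definition is_stream n (G : sgraph n) (s : seq {set 'I_n}) : Prop :=
  uniq s /\ s =i edges G.

(* The [S]-bit memory is the only thing counted as space. All the randomness is
   carried by [seed], whose law is an arbitrary probability measure; the index
   of the current token is an argument of [step], so that fresh coins may be
   used at every token (coins that are kept and re-read are also allowed). *)
Record stream_alg (R : realType) (n S : nat) (Out : Type) := StreamAlg {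
  seed_disp : measure_display;
  seed : measurableType seed_disp;
  law : probability seed R;
  init : seed -> S.-tuple bool;
  step : seed -> nat -> S.-tuple bool -> {set 'I_n} -> S.-tuple bool;
  output : seed -> S.-tuple bool -> Out
}.

Section Run.
Variables (R : realType) (n S : nat) (Out : Type) (A : stream_alg R n S Out).

Fixpoint run_from (w : seed A) (t : nat) (m : S.-tuple bool)
    (s : seq {set 'I_n}) : S.-tuple bool :=
  if s is e :: s' then run_from w t.+1 (step w t m e) s' else m.

Definition result (w : seed A) (s : seq {set 'I_n}) : Out :=
  output w (run_from w 0 (init w) s).

Definition solves (good : sgraph n -> Out -> Prop) : Prop :=
  forall (G : sgraph n) (s : seq {set 'I_n}), is_stream G s ->
    let success := [set w : seed A | good G (result w s)] in
    measurable success /\ ((2 / 3)%:E <= law A success)%E.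

End Run.

Definition solvable_in (R : realType) (n S : nat) (Out : Type)
    (good : sgraph n -> Out -> Prop) : Prop :=
  exists A : stream_alg R n S Out, solves A good.

Definition proper_coloring n (G : sgraph n) (k : nat) (f : 'I_n -> nat) : Prop :=
  (forall v, (f v < k)%N) /\ (forall u v, adj G u v -> f u <> f v).

Definition coloring_task (lam : forall n, sgraph n -> nat) (n : nat)
    (G : sgraph n) (f : 'I_n -> nat) : Prop :=
  proper_coloring G (degeneracy G + lam n G) f.

Definition estimate_task (R : realType) (lam : forall n, sgraph n -> nat)
    (n : nat) (G : sgraph n) (khat : R) : Prop :=
  `|khat - (degeneracy G)%:R| <= (lam n G)%:R.

Definition soft_O_linear (R : realType) (S : nat -> nat) : Prop :=
  exists (C : R) (k n0 : nat), forall n : nat, (n0 <= n)%N ->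
    (S n)%:R <= C * n%:R * ln (n%:R : R) ^+ k.

Definition semi_streaming (R : realType) (Out : nat -> Type)
    (good : forall n, sgraph n -> Out n -> Prop) : Prop :=
  exists S : nat -> nat, soft_O_linear R S /\
    forall n, solvable_in R (S n) (@good n).

(* [lam = O(kappa ^ a)], as the degeneracy grows, over all graphs *)
Definition big_O_degeneracy_pow (R : realType) (lam : forall n, sgraph n -> nat)
    (a : R) : Prop :=
  exists (C : R) (k0 : nat), forall n (G : sgraph n), (k0 <= degeneracy G)%N ->
    (lam n G)%:R <= C * (degeneracy G)%:R `^ a.

(* Main.v *)
Require Import Defs.
From HB Require Import structures.
From mathcomp Require Import all_boot all_order all_algebra zify.

(** Reduction from INDEX with [p ^ 2] bits [x i j]. With [q = 2 lam + 1], take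
    blocks [U_i], [V_j^false], [V_j^true] of [q] vertices each, and a set [K] of
    [p q] vertices, so that [4 p q <= n]. Alice joins [U_i] completely to
    [V_j^(x i j)]; Bob, who wants [x i j], makes [U_i :|: K] and
    [V_j^true :|: K] cliques. If [x i j] holds, then [U_i :|: V_j^true :|: K]
    is a clique and the degeneracy is at least [p q + 2 q - 1]; otherwise it
    is at most [p q + q - 1]. The gap [q] exceeds [2 lam], and for colorings
    Bob checks whether the colors on [U_i] and on [V_j^true] are disjoint,
    which [kappa + lam] colors do not permit when the edges are absent.

    For INDEX itself, fix a seed that is right on two thirds of all pairs
    (input, position). For every decoded word [y], the sum over all words [x] of
    [2 ^ agreement x y] is [3 ^ N]; summing over the [2 ^ S] memory states and
    using convexity gives [2 ^ S * 3 ^ N >= 2 ^ (N + 2 N / 3)], up to rounding,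
    and [2 ^ (5 / 3) > 3]. *)

Set Implicit Arguments.
Unset Strict Implicit.
Unset Printing Implicit Defensive.

(** * Counting bound for INDEX *)

Section Counting.
Variable I : finType.
Implicit Types x y : {ffun I -> bool}.

Definition agreement x y := #|[set i | x i == y i]|.

(** The summand is a product over positions, so the sum factors, and each position contributes
    [2 + 1]. *)
Lemma sum_exp2_agreement y :
  \sum_(x : {ffun I -> bool}) 2 ^ agreement x y = 3 ^ #|I|.
Proof.
transitivity (\sum_(x : {ffun I -> bool})
    \prod_i (if x i == y i then 2 else 1)).
  apply: eq_bigr => x _; rewrite -big_mkcond /= prod_nat_const /agreement.
  by congr (2 ^ _); apply: eq_card => i; rewrite inE.
rewrite -(bigA_distr_bigA (fun i b => if b == y i then 2 else 1)) /=.
rewrite -[#|I|]/(#|predT|) -prod_nat_const; apply: eq_bigr => i _.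
by rewrite big_bool; case: (y i).
Qed.

(* The secant of [2 ^ _] through [A] and [A.+1] lies below it at every
   integer. *)
Lemma exp2_tangent a A : 2 ^ A * a.+1 <= 2 ^ a + 2 ^ A * A.
Proof.
have [leAa|ltaA] := leqP A a.
  rewrite -(subnK leAa) addnC expnD -addnS mulnDr addnC leq_add2r.
  by rewrite leq_mul2l ltn_expl ?orbT.
by apply: leq_trans (leq_addl _ _); rewrite leq_mul2l ltaA orbT.
Qed.

Lemma index_counting_bound S (enc : {ffun I -> bool} -> S.-tuple bool)
    (dec : S.-tuple bool -> {ffun I -> bool}) :
  2 * (#|I| * 2 ^ #|I|) <= 3 * \sum_x agreement x (dec (enc x)) ->
  #|I| <= 29 * maxn 1 S.
Proof.
set N := #|I| => le_avg; pose A := (2 * N) %/ 3.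
have cardx : #|{ffun I -> bool}| = 2 ^ N by rewrite card_ffun card_bool.
have upper : \sum_x 2 ^ agreement x (dec (enc x)) <= 2 ^ S * 3 ^ N.
  apply: (@leq_trans (\sum_x \sum_m 2 ^ agreement x (dec m))).
    by apply: leq_sum => x _; rewrite (bigD1 (enc x)) //= leq_addr.
  rewrite exchange_big /= (eq_bigr (fun=> 3 ^ N)) => [|m _]; last first.
    exact: sum_exp2_agreement.
  by rewrite sum_nat_const card_tuple card_bool.
have lower : 2 ^ A * 2 ^ N <= \sum_x 2 ^ agreement x (dec (enc x)).
  have : \sum_x 2 ^ A * (agreement x (dec (enc x))).+1 <=
         \sum_x (2 ^ agreement x (dec (enc x)) + 2 ^ A * A).
    by apply: leq_sum => x _; exact: exp2_tangent.
  rewrite big_split /= -big_distrr /= sum_nat_const cardx.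
  rewrite (eq_bigr (fun x => agreement x (dec (enc x)) + 1)); last first.
    by move=> x _; rewrite addn1.
  rewrite big_split /= sum_nat_const cardx.
  have leA : A * 2 ^ N <= \sum_x agreement x (dec (enc x)).
    have : 3 * A <= 2 * N by rewrite mulnC leq_trunc_div.
    by move: le_avg; move: (2 ^ N) => E; nia.
  have {leA} := leq_mul (leqnn (2 ^ A)) leA.
  move: A (\sum_x agreement x _) (\sum_x 2 ^ _) (2 ^ N) (2 ^ A).
  by move=> B s X E F; nia.
have exp_le a b k : a <= b -> a ^ k <= b ^ k.
  by case: k => // k; rewrite leq_exp2r.
(* [(32/27)^2 >= 4/3], hence [(32/27)^5 >= (16/9) (32/27) > 2]: every five positions gain a factor
   [2]. *)
have exp5 a b : a = 27 -> b = 32 -> 2 * a ^ 5 <= b ^ 5.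
  move=> a27 b32; have le2 : 4 * a ^ 2 <= 3 * b ^ 2 by rewrite a27 b32.
  have -> : a ^ 5 = 27 * (a ^ 2 * a ^ 2) by rewrite -[in RHS]a27 -expnD -expnS.
  have -> : b ^ 5 = 32 * (b ^ 2 * b ^ 2) by rewrite -[in RHS]b32 -expnD -expnS.
  by have := leq_mul le2 le2; move: (a ^ 2) (b ^ 2) => E F; nia.
have main : 2 ^ (N %/ 5) <= 2 ^ (3 * S + 2).
  (* Cubing [lower] and [upper] gives [2 ^ (3 A + 3 N) <= 2 ^ (3 S) * 27 ^ N]; as [3 A >= 2 N - 2],
     a factor [2 ^ 2] pays for the rounding. *)
  have le35 : 32 ^ N <= 2 ^ (3 * S + 2) * 27 ^ N.
    have := leq_trans lower upper; rewrite -(@leq_exp2r _ _ 3) // !expnMn.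
    rewrite -!expnM -expnD => le3; rewrite -[32]/(2 ^ 5) -[27]/(3 ^ 3) -!expnM.
    apply: (@leq_trans (2 ^ (A * 3 + N * 3) * 2 ^ 2)).
      by rewrite -expnD leq_exp2l // /A; lia.
    by rewrite (expnD 2 (3 * S)) (mulnC 3 S) (mulnC 3 N) mulnAC leq_mul.
  have le5 a b : a = 27 -> b = 32 -> 2 ^ (N %/ 5) * a ^ N <= b ^ N.
    move=> a27 b32; rewrite {2 3}(divn_eq N 5) !expnD !(mulnC _ 5) !expnM.
    rewrite mulnA -expnMn leq_mul ?exp_le ?exp5 //.
    by rewrite a27 b32.
  by have := leq_trans (le5 _ _ erefl erefl) le35; rewrite leq_pmul2r ?expn_gt0.
(* [N %/ 5 <= 3 S + 2] gives [N <= 15 S + 14], which is at most [29 * maxn 1 S]. *)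
by move: main; rewrite leq_exp2l //; lia.
Qed.

End Counting.

(** * Degeneracy of the graphs of the reduction *)

Section Degeneracy.
Variables (n : nat) (G : sgraph n).

Lemma degeneracyP : degenerate G (degeneracy G).
Proof. by rewrite /degeneracy; case: ex_minnP. Qed.

Lemma degeneracy_le k : degenerate G k -> degeneracy G <= k.
Proof. by rewrite /degeneracy; case: ex_minnP => m _; apply. Qed.

Lemma degeneracy_le_order : degeneracy G <= n.
Proof.
apply: degeneracy_le; apply/forallP => U; apply/implyP => /set0Pn[v vU].
apply/existsP; exists v; rewrite vU /=.
by rewrite -[leqRHS]card_ord; exact: max_card.
Qed.

Definition clique (Q : {set 'I_n}) := {in Q &, forall v w, v != w -> adj G v w}.

Lemma clique_degeneracy (Q : {set 'I_n}) :
  clique Q -> #|Q| <= (degeneracy G).+1.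
Proof.
move=> cliqueQ; have [->|Qn0] := eqVneq Q set0; first by rewrite cards0.
have /forallP/(_ Q) := degeneracyP; rewrite Qn0 /= => /existsP[v /andP[vQ]].
rewrite -ltnS; apply: leq_trans; rewrite (cardsD1 v) vQ add1n ltnS.
apply: subset_leq_card; apply/subsetP => w; rewrite !inE => /andP[wv wQ].
by rewrite wQ cliqueQ // eq_sym.
Qed.

Lemma injective_coloring_card (Q : {set 'I_n}) k (f : 'I_n -> nat) :
  (forall v, f v < k) -> {in Q &, injective f} -> #|Q| <= k.
Proof.
move=> lt_f inj_f; pose g v := Ordinal (lt_f v).
rewrite -[k]card_ord -(@card_in_imset _ _ g) ?max_card // => v w vQ wQ [].
exact: inj_f.
Qed.

End Degeneracy.

(** * Graphs given by an edge list *)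

Section StreamGraph.
Variables (n : nat) (s : seq {set 'I_n}).

Definition stream_adj : rel 'I_n := fun v w => (v != w) && ([set v; w] \in s).

Lemma stream_adj_sym : symmetric stream_adj.
Proof. by move=> v w; rewrite /stream_adj eq_sym setUC. Qed.

Lemma stream_adj_irrefl : irreflexive stream_adj.
Proof. by move=> v; rewrite /stream_adj eqxx. Qed.

Definition stream_graph := SGraph stream_adj_sym stream_adj_irrefl.

Lemma stream_graphP :
  uniq s -> (forall e, e \in s -> #|e| = 2) -> is_stream stream_graph s.
Proof.
move=> uniqs card2; split=> // e; apply/idP/imsetP.
  move=> es; have /eqP/cards2P[v [w [vw def_e]]] := card2 e es.
  by exists (v, w); rewrite // inE /= /stream_adj vw -def_e.
by case=> -[v w]; rewrite inE /= /stream_adj => /andP[_ es ->].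
Qed.

End StreamGraph.

(** * The graph of the INDEX reduction *)

Section IndexGraph.
Variables (n p q : nat).

(* ((false, false), (i, a)) is vertex a of the block U_i, ((true, b), (j, a))
   is vertex a of the block V_j^b and ((false, true), _) is a vertex of K. *)
Definition vertex : Type := (bool * bool) * ('I_p * 'I_q).

Variable f : vertex -> 'I_n.
Hypothesis f_inj : injective f.

Definition Ublock i := [set f ((false, false), (i, a)) | a : 'I_q].
Definition Vblock b j := [set f ((true, b), (j, a)) | a : 'I_q].
Definition Kblock := [set f ((false, true), c) | c : 'I_p * 'I_q].

Lemma card_Ublock i : #|Ublock i| = q.
Proof. by rewrite card_imset ?card_ord // => a b /f_inj[]. Qed.

Lemma card_Vblock b j : #|Vblock b j| = q.
Proof. by rewrite card_imset ?card_ord // => a c /f_inj[]. Qed.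

Lemma card_Kblock : #|Kblock| = p * q.
Proof. by rewrite card_imset ?card_prod ?card_ord // => a c /f_inj[]. Qed.

Lemma disjoint_UV i b j : [disjoint Ublock i & Vblock b j].
Proof.
apply/pred0P => v /=; apply/andP => -[/imsetP[a _ ->] /imsetP[c _ /f_inj]].
by [].
Qed.

Lemma disjoint_UK i : [disjoint Ublock i & Kblock].
Proof.
by apply/pred0P => v /=; apply/andP => -[/imsetP[a _ ->] /imsetP[c _ /f_inj]].
Qed.

Lemma disjoint_VK b j : [disjoint Vblock b j & Kblock].
Proof.
by apply/pred0P => v /=; apply/andP => -[/imsetP[a _ ->] /imsetP[c _ /f_inj]].
Qed.

Implicit Types (x : {ffun 'I_p * 'I_p -> bool}) (ij : 'I_p * 'I_p).

Definition alice_edge x (t : ('I_p * 'I_p) * ('I_q * 'I_q)) : {set 'I_n} :=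
  [set f ((false, false), (t.1.1, t.2.1)); f ((true, x t.1), (t.1.2, t.2.2))].

(* Its length does not depend on [x]: the second half of the stream starts at a
   token index that is known without knowing [x]. *)
Definition alice_stream x :=
  [seq alice_edge x t | t <- enum {: ('I_p * 'I_p) * ('I_q * 'I_q)}].

(** Enumerating one set, rather than concatenating two cliques, lists the edges inside [K] only
    once. *)
Definition bob_stream ij :=
  enum [set e : {set 'I_n} | (#|e| == 2) &&
    ((e \subset Ublock ij.1 :|: Kblock) ||
     (e \subset Vblock true ij.2 :|: Kblock))].

Definition index_graph x ij := stream_graph (alice_stream x ++ bob_stream ij).

Lemma size_alice_stream x x' : size (alice_stream x) = size (alice_stream x').
Proof. by rewrite !size_map. Qed.

Lemma alice_edge_inj x : injective (alice_edge x).
Proof.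
move=> [[i j] [a b]] [[i' j'] [a' b']] eq_e.
have : f ((false, false), (i, a)) \in alice_edge x ((i', j'), (a', b')).
  by rewrite -eq_e set21.
have : f ((true, x (i, j)), (j, b)) \in alice_edge x ((i', j'), (a', b')).
  by rewrite -eq_e set22.
by case/set2P=> /f_inj // [_ -> ->] /set2P[/f_inj[-> ->]|/f_inj].
Qed.

Lemma index_graph_stream x ij :
  is_stream (index_graph x ij) (alice_stream x ++ bob_stream ij).
Proof.
apply: stream_graphP => [|e].
  rewrite cat_uniq enum_uniq map_inj_uniq ?enum_uniq /= ?andbT; last first.
    exact: alice_edge_inj.
  (* Alice's edges run from a [U] block to a [V] block, while neither of Bob's cliques contains
     vertices of both kinds. *)
  apply/hasPn => e; rewrite mem_enum inE => /andP[_ sub_e].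
  apply/mapP => -[[[i' j'] [a b]] _ def_e].
  move: sub_e; rewrite def_e /alice_edge !subUset !sub1set !inE /=.
  by case/orP=> /andP[/orP[] /imsetP[? _ /f_inj // _]
    /orP[] /imsetP[? _ /f_inj // _]].
rewrite mem_cat mem_enum inE => /orP[/mapP[t _ ->]|/andP[/eqP //]].
by rewrite cards2 (inj_eq f_inj).
Qed.

Lemma index_graph_adj x ij v w : adj (index_graph x ij) v w =
  (v != w) && (([set v; w] \in alice_stream x) ||
   [|| (v \in Ublock ij.1 :|: Kblock) && (w \in Ublock ij.1 :|: Kblock) |
       (v \in Vblock true ij.2 :|: Kblock) &&
       (w \in Vblock true ij.2 :|: Kblock)]).
Proof.
rewrite /= /stream_adj mem_cat; have [//|vw /=] := eqVneq v w.
by rewrite mem_enum inE cards2 vw /= !subUset !sub1set.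
Qed.

Lemma clique_UK x ij : clique (index_graph x ij) (Ublock ij.1 :|: Kblock).
Proof. by move=> v w vQ wQ vw; rewrite index_graph_adj vw vQ wQ orbT. Qed.

Lemma clique_VK x ij : clique (index_graph x ij) (Vblock true ij.2 :|: Kblock).
Proof. by move=> v w vQ wQ vw; rewrite index_graph_adj vw vQ wQ !orbT. Qed.

Lemma adj_UV x ij v w : v \in Ublock ij.1 -> w \in Vblock true ij.2 ->
  adj (index_graph x ij) v w = x ij.
Proof.
move=> vU wV; rewrite index_graph_adj.
have vw : v != w.
  by apply: contraTneq vU => ->; rewrite (disjointFl (disjoint_UV _ _ _) wV).
rewrite vw !in_setU vU wV (disjointFr (disjoint_UV _ _ _) vU).
rewrite (disjointFl (disjoint_UV _ _ _) wV) (disjointFr (disjoint_UK _) vU).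
rewrite (disjointFr (disjoint_VK _ _) wV) /= orbF.
case: ij vU wV => i j /= /imsetP[a _ def_v] /imsetP[b _ def_w].
apply/mapP/idP => [[[[i' j'] [a' b']] _]|xij].
  move=> eq_e; have : v \in [set v; w] by rewrite set21.
  have : w \in [set v; w] by rewrite set22.
  rewrite eq_e def_v def_w => /set2P[/f_inj //|/f_inj[xij -> _]].
  by case/set2P=> /f_inj // [-> _]; rewrite -xij.
by exists ((i, j), (a, b)); rewrite ?mem_enum // /alice_edge /= xij def_v def_w.
Qed.

Definition bob_vertices ij := Ublock ij.1 :|: Vblock true ij.2 :|: Kblock.

Lemma card_bob_vertices ij : #|bob_vertices ij| = p * q + 2 * q.
Proof.
have disjointUV := disjoint_setI0 (disjoint_UV ij.1 true ij.2).
have disjointUK := disjoint_setI0 (disjoint_UK ij.1).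
have disjointVK := disjoint_setI0 (disjoint_VK true ij.2).
rewrite cardsU setIUl disjointUK disjointVK setU0 cards0 subn0.
rewrite cardsU disjointUV cards0 subn0 card_Ublock card_Vblock card_Kblock.
by rewrite mul2n addnn addnC.
Qed.

Lemma clique_bob_vertices x ij :
  x ij -> clique (index_graph x ij) (bob_vertices ij).
Proof.
move=> xij v w; rewrite !in_setU => /orP[/orP[]|] vin /orP[/orP[]|] win vw.
- by apply: clique_UK; rewrite // in_setU ?vin ?win.
- by rewrite adj_UV.
- by apply: clique_UK; rewrite // in_setU ?vin ?win ?orbT.
- by rewrite adj_sym adj_UV.
- by apply: clique_VK; rewrite // in_setU ?vin ?win.
- by apply: clique_VK; rewrite // in_setU ?vin ?win ?orbT.
- by apply: clique_UK; rewrite // in_setU ?vin ?win ?orbT.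
- by apply: clique_VK; rewrite // in_setU ?vin ?win ?orbT.
- by apply: clique_UK; rewrite // in_setU ?vin ?win ?orbT.
Qed.

(** Valid for either value of the bit, so a bound on [lam] known only for large degeneracy applies
    to every graph of the reduction. *)
Lemma degeneracy_index_graph_ge x ij :
  0 < q -> p * q <= degeneracy (index_graph x ij).
Proof.
move=> q_gt0; have := clique_degeneracy (@clique_UK x ij).
rewrite cardsU (disjoint_setI0 (disjoint_UK _)) cards0 subn0.
by rewrite card_Ublock card_Kblock; lia.
Qed.

Lemma degeneracy_index_graph_true x ij :
  x ij -> p * q + 2 * q <= (degeneracy (index_graph x ij)).+1.
Proof.
by move=> xij; rewrite -(card_bob_vertices ij) clique_degeneracy //;
  exact: clique_bob_vertices.
Qed.

(** Such a vertex meets only Alice's edges. In [U_i] it sees one of the two blocks [V_j] for each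
    [j]; in a [V] block it sees at most all [U] blocks. Either way the neighbors are indexed by a
    block and a position. *)
Lemma subdeg_other x ij U v :
  v \notin bob_vertices ij -> subdeg (index_graph x ij) U v <= p * q.
Proof.
rewrite !in_setU !negb_or => /andP[/andP[vU vV] vK].
have nbrs w : adj (index_graph x ij) v w ->
    exists i a j b, let u := f ((false, false), (i, a)) in
      let u' := f ((true, x (i, j)), (j, b)) in
      v = u /\ w = u' \/ v = u' /\ w = u.
  rewrite index_graph_adj !in_setU (negPf vU) (negPf vV) (negPf vK) /= orbF.
  case/andP=> vw /mapP[[[i j] [a b]] _ eq_e]; exists i, a, j, b => /=.
  have : v \in [set v; w] by rewrite set21.
  have : w \in [set v; w] by rewrite set22.
  rewrite eq_e => /set2P[] def_w /set2P[] def_v.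
  - by rewrite def_v def_w eqxx in vw.
  - by right.
  - by left.
  - by rewrite def_v def_w eqxx in vw.
suff [g sub_g] : exists g : 'I_p * 'I_q -> 'I_n, forall w,
    adj (index_graph x ij) v w -> exists c, w = g c.
  apply: (@leq_trans #|[set g c | c : 'I_p * 'I_q]|).
    apply: subset_leq_card; apply/subsetP => w.
    rewrite inE => /andP[_ /sub_g[c ->]]; exact: imset_f.
  by apply: leq_trans (leq_imset_card _ _) _; rewrite card_prod !card_ord.
have [/existsP[[i a] /eqP def_v]|/existsPn not_U] :=
    boolP [exists c, v == f ((false, false), c)].
  exists (fun c => f ((true, x (i, c.1)), c)) => w /nbrs[i' [a' [j [b]]]] /=.
  rewrite def_v => -[[/f_inj[-> _] ->]|[/f_inj //]].
  by exists (j, b).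
exists (fun c => f ((false, false), c)) => w /nbrs[i' [a' [j [b]]]] /=.
case=> -[def_v ->]; last by exists (i', a').
by have := not_U (i', a'); rewrite def_v eqxx.
Qed.

(** A vertex outside Bob's blocks has low degree. Otherwise, as no edge joins [U_i] to [V_j^true], a
    vertex of [U_i] has all its neighbors in [U_i :|: K]; if [U] avoids [U_i], it lies within
    [V_j^true :|: K]. *)
Lemma degeneracy_index_graph_false x ij :
  0 < q -> ~~ x ij -> degeneracy (index_graph x ij) < p * q + q.
Proof.
move=> q_gt0 /negPf nxij; rewrite -(ltn_predK (ltn_addl _ q_gt0)) ltnS.
apply: degeneracy_le; apply/forallP => U; apply/implyP => /set0Pn[u0 u0U].
apply/existsP.
have [/existsP[v /andP[vU vQ]]|/existsPn sub_Q] :=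
    boolP [exists v, (v \in U) && (v \notin bob_vertices ij)].
  by exists v; rewrite vU (leq_trans (subdeg_other _ _ vQ)) //; lia.
have clique_side (W : {set 'I_n}) v : v \in U -> v \in W -> #|W| <= p * q + q ->
    (forall w, w \in U -> adj (index_graph x ij) v w -> w \in W) ->
  exists v, (v \in U) && (subdeg (index_graph x ij) U v <= (p * q + q).-1).
  move=> vU vW cardW nbrs; exists v; rewrite vU /=.
  rewrite (cardsD1 v) vW in cardW; apply: (@leq_trans #|W :\ v|); last by lia.
  apply: subset_leq_card; apply/subsetP => w; rewrite !inE => /andP[wU vw].
  by rewrite nbrs // andbT; apply: contraTneq vw => ->; rewrite adj_irrefl.
have cardUK i : #|Ublock i :|: Kblock| <= p * q + q.
  by rewrite cardsU card_Ublock card_Kblock; lia.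
have cardVK j : #|Vblock true j :|: Kblock| <= p * q + q.
  by rewrite cardsU card_Vblock card_Kblock; lia.
have inQ w : w \in U -> w \in bob_vertices ij.
  by move=> wU; have := sub_Q w; rewrite wU negbK.
have [/existsP[v /andP[vU vA]]|/existsPn sub_VK] :=
    boolP [exists v, (v \in U) && (v \in Ublock ij.1)].
  apply: (clique_side (Ublock ij.1 :|: Kblock) v) => // [|w wU vw].
    by rewrite in_setU vA.
  have := inQ w wU; rewrite !in_setU => /orP[/orP[-> //|wB]|->]; last first.
    exact: orbT.
  by rewrite adj_UV ?nxij in vw.
apply: (clique_side (Vblock true ij.2 :|: Kblock) u0) => // [|w wU _].
  by have := inQ _ u0U; have := sub_VK u0; rewrite u0U !in_setU /= => /negPf ->.
by have := inQ _ wU; have := sub_VK w; rewrite wU !in_setU /= => /negPf ->.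
Qed.

End IndexGraph.

(** * From streaming algorithms to INDEX *)

From mathcomp Require Import all_classical all_reals all_analysis.
From mathcomp Require Import measurable_realfun ring lra.
Import Order.TTheory GRing.Theory Num.Theory.
Local Open Scope ring_scope.

(** By linearity of expectation, the mean number of events that occur is at least [2/3] of [#|J|],
    so some seed attains it. *)
Lemma exists_good_seed (R : realType) (d : measure_display)
    (T : measurableType d) (P : probability T R) (J : finType)
    (E : J -> set T) :
  (forall j, measurable (E j)) -> (forall j, ((2 / 3)%:E <= P (E j))%E) ->
  exists w, (2 * #|J| <= 3 * \sum_j `[< E j w >])%N.
Proof.
move=> mE leE; apply: contrapT => /forallNP few.
(* Counts are integers, so a uniform failure leaves a gap of [1/3], and comparing integrals weakly
   suffices. *)
pose M : R := ((2 * #|J|)%:R - 1) / 3.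
have count_le w : (\sum_j (\1_(E j) w)%:E <= M%:E)%E.
  rewrite (eq_bigr (fun j => (`[< E j w >]%:R : R)%:E)); last first.
    by move=> j _; rewrite indicE.
  rewrite sumEFin lee_fin -natr_sum.
  have /negP := few w; rewrite -ltnNge -addn1 -(ler_nat R) natrD (natrM _ 3).
  by rewrite /M; lra.
have : (\sum_j P (E j) <= M%:E)%E.
  have -> : (\sum_j P (E j) = \int[P]_w \sum_j (\1_(E j) w)%:E)%E.
    rewrite ge0_integral_sum //.
    - by apply: eq_bigr => j _; rewrite integral_indic // setIT.
    - by move=> j; apply/measurable_EFinP; exact: measurable_indic.
  apply: (@le_trans _ _ (\int[P]_w (cst M%:E) w)%E).
    apply: ge0_le_integral => //.
    - by move=> w _; apply: sume_ge0 => j _; rewrite lee_fin.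
    - apply: emeasurable_sum => j; apply/measurable_EFinP.
      exact: measurable_indic.
  by rewrite integral_cst // [X in (_ * X)%E]probability_setT mule1.
apply/negP; rewrite -ltNge.
apply: (@lt_le_trans _ _ (\sum_(j : J) (2 / 3)%:E)%E).
  by rewrite sumEFin lte_fin sumr_const -mulr_natr /M natrM; lra.
by apply: lee_sum => j _.
Qed.

Lemma run_from_cat (R : realType) (n S : nat) (Out : Type)
    (A : stream_alg R n S Out) (w : seed A) t m (s1 s2 : seq {set 'I_n}) :
  run_from w t m (s1 ++ s2) =
  run_from w (t + size s1) (run_from w t m s1) s2.
Proof.
elim: s1 t m => [|e s1 IHs] t m /=; first by rewrite addn0.
by rewrite IHs addSnnS.
Qed.

Section Reduction.
Variables (R : realType) (n S p q : nat) (f : vertex p q -> 'I_n).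
Hypothesis f_inj : injective f.

(** With the seed fixed, the memory after Alice's half encodes [x] deterministically. Bob can resume
    from this same state once per position, which decodes a whole word. *)
Lemma index_reduction (Out : Type) (good : sgraph n -> Out -> Prop)
    (decode : 'I_p * 'I_p -> Out -> bool) :
  (forall x ij o, good (index_graph f x ij) o -> decode ij o = x ij) ->
  solvable_in R S good -> (p * p <= 29 * maxn 1 S)%N.
Proof.
move=> decodeP [A solvesA].
pose str (j : {ffun 'I_p * 'I_p -> bool} * ('I_p * 'I_p)) :=
  alice_stream f j.1 ++ bob_stream f j.2.
pose E j := [set w : seed A |
  good (index_graph f j.1 j.2) (result w (str j))]%classic.
have [|j|w] := @exists_good_seed R _ _ (law A) _ E.
- by move=> j; have [] := solvesA _ _ (index_graph_stream f_inj j.1 j.2).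
- by have [] := solvesA _ _ (index_graph_stream f_inj j.1 j.2).
pose enc x := run_from w 0 (init w) (alice_stream f x).
pose len := size (alice_stream f [ffun=> false]).
pose dec m : {ffun 'I_p * 'I_p -> bool} :=
  [ffun ij => decode ij (output w (run_from w len m (bob_stream f ij)))].
move=> many.
have := @index_counting_bound _ S enc dec; rewrite card_prod !card_ord; apply.
rewrite card_prod card_ffun card_prod card_bool card_ord in many.
rewrite (mulnC (p * p)%N); apply: leq_trans many _; rewrite leq_mul2l /=.
under [leqRHS]eq_bigr => x _ do rewrite /agreement -sum1_card big_mkcond /=.
rewrite pair_big /=; apply: leq_sum => -[x ij] _.
rewrite inE /dec ffunE; case: asboolP => // /decodeP /= <-.
rewrite /result /str run_from_cat add0n /=.
by rewrite (size_alice_stream _ x [ffun=> false]) eqxx.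
Qed.

Variables (lam : forall n, sgraph n -> nat) (L : nat).
Hypothesis L_lt : (2 * L < q)%N.
Hypothesis lamL : forall G : sgraph n, (p * q <= degeneracy G -> lam G <= L)%N.

Let q_gt0 : (0 < q)%N. Proof. by lia. Qed.

Lemma lam_index_graph x ij : (lam (index_graph f x ij) <= L)%N.
Proof. by apply: lamL; exact: degeneracy_index_graph_ge. Qed.

(** If the bit is false but the colors on the two blocks are disjoint, then all [p q + 2 q] vertices
    of [bob_vertices] have distinct colors, while at most [p q + q - 1 + L] colors are available. *)
Lemma coloring_lower_bound :
  solvable_in R S (@coloring_task lam n) -> (p * p <= 29 * maxn 1 S)%N.
Proof.
pose decode (ij : 'I_p * 'I_p) (c : 'I_n -> nat) :=
  [forall v in Ublock f ij.1, forall w in Vblock f true ij.2, c v != c w].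
apply: (@index_reduction _ _ decode) => x ij c [lt_c proper_c].
have [xij|nxij] := boolP (x ij).
  apply/forall_inP => v vU; apply/forall_inP => w wV.
  by apply/eqP/proper_c; rewrite (adj_UV f_inj).
apply/negP => /forall_inP distinct.
have {distinct}distinct v w : v \in Ublock f ij.1 -> w \in Vblock f true ij.2 ->
    c v <> c w.
  by move=> vU wV; apply/eqP; have /forall_inP := distinct v vU; apply.
have cliqueP (Q : {set 'I_n}) : clique (index_graph f x ij) Q ->
    {in Q &, injective c}.
  move=> cliqueQ v w vQ wQ cvw; apply: contrapT => /eqP vw.
  exact: proper_c (cliqueQ v w vQ wQ vw) cvw.
have inj_c : {in bob_vertices f ij &, injective c}.
  have injUK := cliqueP _ (@clique_UK _ _ _ f x ij).
  have injVK := cliqueP _ (@clique_VK _ _ _ f x ij).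
  move=> v w; rewrite !finset.in_setU.
  move=> /orP[/orP[]|] vin /orP[/orP[]|] win cvw.
  - by apply: injUK; rewrite // finset.in_setU ?vin ?win.
  - by case: (distinct v w).
  - by apply: injUK; rewrite // finset.in_setU ?vin ?win ?orbT.
  - by case: (distinct w v).
  - by apply: injVK; rewrite // finset.in_setU ?vin ?win.
  - by apply: injVK; rewrite // finset.in_setU ?vin ?win ?orbT.
  - by apply: injUK; rewrite // finset.in_setU ?vin ?win ?orbT.
  - by apply: injVK; rewrite // finset.in_setU ?vin ?win ?orbT.
  - by apply: injUK; rewrite // finset.in_setU ?vin ?win ?orbT.
have := injective_coloring_card lt_c inj_c; rewrite (card_bob_vertices f_inj).
have := degeneracy_index_graph_false f_inj q_gt0 nxij.
have := lam_index_graph x ij; lia.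
Qed.

Lemma estimate_lower_bound :
  solvable_in R S (@estimate_task R lam n) -> (p * p <= 29 * maxn 1 S)%N.
Proof.
(* As [q - 1 >= 2 L], a true bit forces degeneracy at least [p q + q + 2 L], and a false one at most
   [p q + q - 1]; an error of [L] does not cross this threshold. *)
pose decode (ij : 'I_p * 'I_p) (k : R) := (p * q + q + L)%:R <= k.
apply: (@index_reduction _ _ decode) => x ij k.
rewrite /estimate_task /decode => close.
have {close} : `|k - (degeneracy (index_graph f x ij))%:R| <= L%:R.
  by apply: le_trans close _; rewrite ler_nat lam_index_graph.
rewrite ler_norml => /andP[lo hi].
have [xij|nxij] := boolP (x ij).
  have : (p * q + q + L + L <= degeneracy (index_graph f x ij))%N.
    by have := degeneracy_index_graph_true f_inj xij; lia.
  by rewrite -(ler_nat R) !natrD; lra.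
apply/negbTE; rewrite -ltNge.
have : (degeneracy (index_graph f x ij) + 1 <= p * q + q)%N.
  by have := degeneracy_index_graph_false f_inj q_gt0 nxij; lia.
by rewrite -(ler_nat R) !natrD; lra.
Qed.

End Reduction.

Lemma vertex_embedding n p q : (4 * (p * q) <= n)%N ->
  exists f : vertex p q -> 'I_n, injective f.
Proof.
move=> le_n; have card_le : (#|{: vertex p q}| <= n)%N.
  by rewrite /vertex !card_prod card_bool !card_ord.
exists (fun t => widen_ord card_le (enum_rank t)) => t u /(congr1 val) /= eq_tu.
by apply: enum_rank_inj; exact: val_inj.
Qed.

(** Absorbs the rounding in [block_count]: [(r + 1)^2 <= 2 r^2 + 2 <= 58 m + 2]. *)
Lemma sqrS_le m r :
  (1 <= m -> r * r <= 29 * m -> r.+1 * r.+1 <= 60 * m)%N.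
Proof.
move=> m1 le_r; have := (nat_Cauchy r 1).1.
rewrite -!mulnn muln1 (mulSn r) (mulnS r).
by move: (r * r)%N le_r => s; lia.
Qed.

(** * Choice of the block sizes *)

Section SpaceBound.
Variables (R : realType) (n S : nat).
Variables (lam : forall n, sgraph n -> nat) (L : nat).

Definition block_size := (2 * L).+1.
Definition block_count := (n %/ (4 * block_size))%N.

Hypothesis L_gt0 : (0 < L)%N.
Hypothesis lamL : forall G : sgraph n,
  (block_count * block_size <= degeneracy G -> lam G <= L)%N.

Lemma space_lower_bound :
  solvable_in R S (@coloring_task lam n) \/
    solvable_in R S (@estimate_task R lam n) ->
  (n ^ 2 <= 144 * (60 * (L ^ 2 * maxn 1 S)))%N.
Proof.
move=> solv; pose p := block_count; pose q := block_size.
have [|f f_inj] := @vertex_embedding n p q.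
  by rewrite mulnCA /p /q /block_count leq_trunc_div.
have bound : (p * p <= 29 * maxn 1 S)%N.
  by case: solv; [apply: coloring_lower_bound|apply: estimate_lower_bound];
    try exact: f_inj; try exact: lamL.
have n_lt : (n < p.+1 * (4 * q))%N by apply: ltn_ceil.
(* [4 q = 8 L + 4 <= 12 L] because [L >= 1]; squaring gives the [144]. *)
have le12 : (n <= 12 * (L * p.+1))%N.
  apply: leq_trans (ltnW n_lt) _; rewrite [leqRHS]mulnA mulnC leq_mul2r.
  by rewrite /q /block_size; lia.
have le144 : (n * n <= 144 * (L * L * (p.+1 * p.+1)))%N.
  apply: leq_trans (leq_mul le12 le12) _.
  by rewrite mulnACA leq_mul2l -mulnACA leqnn orbT.
have le60 := sqrS_le (leq_maxl 1 S) bound.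
rewrite -!mulnn; apply: leq_trans le144 _.
by rewrite leq_mul2l /= (mulnCA 60) leq_mul2l le60 orbT.
Qed.

End SpaceBound.

(** * Asymptotics *)

(** Apply [ln y <= y] to [y = x^e] with [e = g / (k + 1)]; then [e k <= g], and [k = 0] causes no
    division by zero. *)
Lemma ln_expn_le_powR (R : realType) (g x : R) (k : nat) : 0 < g -> 1 <= x ->
  ln x ^+ k <= (k.+1%:R / g) ^+ k * x `^ g.
Proof.
move=> g_gt0 x_ge1; pose e := g / k.+1%:R.
have e_gt0 : 0 < e by rewrite divr_gt0 ?ltr0n.
have x_gt0 : 0 < x := lt_le_trans ltr01 x_ge1.
have le_e : ln x <= k.+1%:R / g * x `^ e.
  have -> : k.+1%:R / g = e^-1 by rewrite invf_div.
  rewrite ler_pdivlMl // -ln_powR; apply/ltW/ln_sublinear; exact: powR_gt0.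
apply: (@le_trans _ _ ((k.+1%:R / g * x `^ e) ^+ k)).
  by rewrite lerXn2r // ?nnegrE ?ln_ge0 // (le_trans _ le_e) // ln_ge0.
rewrite exprMn ler_wpM2l ?exprn_ge0 ?divr_ge0 ?(ltW g_gt0) //.
rewrite -powR_mulrn ?powR_ge0 // -powRrM ler_powR //.
by rewrite /e mulrAC ler_pdivrMr ?ltr0n // ler_pM2l // ler_nat.
Qed.

Lemma space_lower_boundR (R : realType) (n S : nat)
    (lam : forall n, sgraph n -> nat) (L : nat) : (0 < L)%N ->
  (forall G : sgraph n,
    (block_count n L * block_size L <= degeneracy G -> lam n G <= L)%N) ->
  solvable_in R S (@coloring_task lam n) \/
    solvable_in R S (@estimate_task R lam n) ->
  n%:R ^+ 2 <= 144 * (60 * (L%:R ^+ 2 * (maxn 1 S)%:R)) :> R.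
Proof.
move=> L_gt0 lamL /(space_lower_bound L_gt0 lamL).
rewrite -(ler_nat R) natrX (natrM _ 144) (natrM _ 60) (natrM _ (L ^ 2)).
by rewrite natrX.
Qed.

(** One large [n] gives the contradiction. With [L] of order [n^(1/2 - g)], the space is at least of
    order [n^(1 + 2 g)], whereas a semi-streaming bound is at most of order [n^(1 + g)]. *)
Lemma no_semi_streaming (R : realType) (gamma : R)
    (lam : forall n, sgraph n -> nat) (S : nat -> nat) :
  0 < gamma -> big_O_degeneracy_pow lam (1 / 2 - gamma) -> soft_O_linear R S ->
  ~ (forall n, solvable_in R (S n) (@coloring_task lam n) \/
       solvable_in R (S n) (@estimate_task R lam n)).
Proof.
move=> gamma_gt0 [C [k0 lamC]] [D [k [n0 leD]]] solv.
(* The minimum keeps [1/2 - g] nonnegative, so that [kappa <= n] bounds the power of [kappa] by that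
   of [n]. *)
pose g := Num.min gamma (1 / 2).
have g_gt0 : 0 < g by rewrite lt_min gamma_gt0; lra.
have [g_gamma g_half] : g <= gamma /\ g <= 1 / 2.
  by rewrite !ge_min !lexx orbT.
pose C1 := Num.max 1 C; pose D1 := Num.max 1 D.
have [C1_ge1 leC1] : 1 <= C1 /\ C <= C1 by rewrite !le_max !lexx orbT.
have [D1_ge1 leD1] : 1 <= D1 /\ D <= D1 by rewrite !le_max !lexx orbT.
pose B := (k.+1%:R / g) ^+ k.
have B_ge0 : 0 <= B by rewrite exprn_ge0 // divr_ge0 // ltW.
pose K := 144 * (60 * (4 * C1 ^+ 2 * (D1 * (B + 1)))).
pose M := 24 * C1 + 4 * k0%:R + 4 + K.
have K_ge0 : 0 <= K by rewrite /K !mulr_ge0 ?exprn_ge0 //; lra.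
have k0_ge0 : 0 <= k0%:R :> R by [].
have M_ge0 : 0 <= M by rewrite /M; lra.
pose n := (n0 + (Num.truncn (M `^ g^-1)).+1)%N.
have n_ge1 : 1 <= n%:R :> R by rewrite ler1n /n addnS.
have n_gt0 : 0 < n%:R :> R by lra.
have n_neq0 : n%:R != 0 :> R by rewrite gt_eqF.
pose X := n%:R `^ g; pose Y := n%:R `^ (1 / 2 - g).
have X_geM : M <= X.
  rewrite -[M](@powRr1 R) // -(mulVf (lt0r_neq0 g_gt0)) powRrM.
  apply: ge0_ler_powR; rewrite ?nnegrE ?powR_ge0 // ?ltW //.
  apply: lt_le_trans (truncnS_gt _) _.
  by rewrite ler_nat /n leq_addl.
have X_ge1 : 1 <= X by rewrite /M in X_geM; lra.
have Y_ge1 : 1 <= Y.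
  by rewrite -(powRr0 n%:R) /Y ler_powR //; lra.
have nXY : n%:R = X ^+ 2 * Y ^+ 2.
  rewrite -exprMn -powRD ?n_neq0 ?implybT //.
  have -> : g + (1 / 2 - g) = 2^-1 by lra.
  by rewrite powR12_sqrt ?sqr_sqrtr.
pose L := (Num.truncn (C1 * Y)).+1.
have CY_ge1 : 1 <= C1 * Y by nra.
have L_ge : C1 * Y <= L%:R by apply/ltW/truncnS_gt.
have L_le : L%:R <= 2 * (C1 * Y).
  have := truncn_le (C1 * Y); rewrite /L -natr1; lra.
(* The graphs of the reduction thus have degeneracy at least [k0], where [lamC] applies, and at
   least [1], where powers grow with the exponent. *)
have big : k0%:R + 1 <= (block_count n L * block_size L)%:R :> R.
  have : (n <= 4 * (block_count n L * block_size L) + 4 * block_size L)%N.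
    have : (n < (block_count n L).+1 * (4 * block_size L))%N by apply: ltn_ceil.
    by rewrite mulSn mulnCA addnC => /ltnW.
  rewrite -(ler_nat R) natrD !(natrM _ 4).
  have -> : (block_size L)%:R = 2 * L%:R + 1 :> R.
    by rewrite /block_size -natr1 (natrM _ 2).
  have X2_ge : 24 * C1 + 4 * k0%:R + 4 <= X ^+ 2.
    by rewrite /M in X_geM; rewrite expr2; nra.
  have Y2_ge : Y <= Y ^+ 2 by rewrite expr2; nra.
  have CY2_ge : C1 * Y <= C1 * Y ^+ 2 by rewrite ler_wpM2l //; lra.
  have : (24 * C1 + 4 * k0%:R + 4) * Y ^+ 2 <= n%:R.
    by rewrite nXY ler_wpM2r // exprn_ge0 //; lra.
  have : k0%:R <= k0%:R * Y ^+ 2 by rewrite ler_peMr //; lra.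
  by rewrite !mulrDl -!mulrA; lra.
have lamL (G : sgraph n) :
    (block_count n L * block_size L <= degeneracy G -> lam n G <= L)%N.
  rewrite -(ler_nat R) => le_deg; rewrite -(ler_nat R).
  have le_k0 : (k0 <= degeneracy G)%N by rewrite -(ler_nat R); lra.
  have deg_ge1 : 1 <= (degeneracy G)%:R :> R by lra.
  apply: le_trans (lamC n G le_k0) _; apply: le_trans L_ge.
  apply: (@le_trans _ _ (C1 * (degeneracy G)%:R `^ (1 / 2 - gamma))).
    by rewrite ler_wpM2r // powR_ge0.
  rewrite ler_wpM2l //; first lra.
  apply: (@le_trans _ _ ((degeneracy G)%:R `^ (1 / 2 - g))).
    by rewrite ler_powR //; lra.
  apply: ge0_ler_powR; rewrite ?nnegrE //; first lra.
  by rewrite ler_nat degeneracy_le_order.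
have S_le : (maxn 1 (S n))%:R <= D1 * (B + 1) * (n%:R * X).
  have nX_ge1 : 1 <= n%:R * X by nra.
  have DB_ge1 : 1 <= D1 * (B + 1) by nra.
  have [_|_] := leqP 1 (S n); last by nra.
  have := leD n (leq_addr _ _); move=> /le_trans; apply.
  have := ln_expn_le_powR k g_gt0 n_ge1; rewrite -/X -/B => ln_le.
  have ln_ge0 : 0 <= ln (n%:R : R) ^+ k by rewrite exprn_ge0 // ln_ge0.
  apply: (@le_trans _ _ (D1 * n%:R * (B * X))).
    apply: (@le_trans _ _ (D1 * n%:R * ln n%:R ^+ k)).
      by rewrite ler_wpM2r // ler_wpM2r.
    by rewrite ler_wpM2l // mulr_ge0 //; lra.
  have -> : D1 * (B + 1) * (n%:R * X) = D1 * n%:R * (B * X) + D1 * (n%:R * X).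
    by ring.
  by rewrite lerDl !mulr_ge0 //; lra.
have := space_lower_boundR (ltn0Sn _) lamL (solv n).
apply/negP; rewrite -ltNge.
apply: (@le_lt_trans _ _
  (144 * (60 * ((2 * (C1 * Y)) ^+ 2 * (D1 * (B + 1) * (n%:R * X)))))).
  rewrite !ler_wpM2l // ler_pM ?exprn_ge0 //.
  by rewrite lerXn2r ?nnegrE //; lra.
have -> : 144 * (60 * ((2 * (C1 * Y)) ^+ 2 * (D1 * (B + 1) * (n%:R * X)))) =
   n%:R * (X * Y ^+ 2) * K by rewrite /K; ring.
(* Both sides now share the factor [n X Y^2], leaving [K < X], which the choice of [M] ensures. *)
have -> : n%:R ^+ 2 = n%:R * (X * Y ^+ 2) * X by rewrite expr2 {2}nXY; ring.
rewrite ltr_pM2l; first by rewrite /M in X_geM; lra.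
by rewrite !mulr_gt0 ?exprn_gt0 //; lra.
Qed.

(* In the first part [lam] is a fixed integer and the constant [c] is uniform in
   [lam] and [n]. An algorithm is charged at least one bit ([maxn 1 S]): for
   [lam >= n] both tasks are trivial and need no memory at all, while
   [n ^ 2 / lam ^ 2] stays positive. *)
Theorem theorem5p6 (R : realType) :
  (exists c : R, 0 < c /\
     forall lam n S : nat, (1 <= lam)%N ->
       (solvable_in R S (@coloring_task (fun _ _ => lam) n) ->
          c * (n%:R ^+ 2 / lam%:R ^+ 2) <= (maxn 1 S)%:R) /\
       (solvable_in R S (@estimate_task R (fun _ _ => lam) n) ->
          c * (n%:R ^+ 2 / lam%:R ^+ 2) <= (maxn 1 S)%:R)) /\
  (forall (gamma : R) (lam : forall n, sgraph n -> nat),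
     0 < gamma ->
     (forall n (G : sgraph n), (1 <= lam n G)%N) ->
     big_O_degeneracy_pow lam (1 / 2 - gamma) ->
     ~ semi_streaming R (@coloring_task lam) /\
     ~ semi_streaming R (@estimate_task R lam)).
Proof.
split.
  exists (144 * 60)^-1; split=> [|lam n S lam_gt0].
    by rewrite invr_gt0; lra.
  have bound : solvable_in R S (@coloring_task (fun _ _ => lam) n) \/
      solvable_in R S (@estimate_task R (fun _ _ => lam) n) ->
      (144 * 60)^-1 * (n%:R ^+ 2 / lam%:R ^+ 2) <= (maxn 1 S)%:R :> R.
    move=> solv; rewrite ler_pdivrMl; last lra.
    rewrite ler_pdivrMr ?exprn_gt0 ?ltr0n // -!mulrA [_%:R * _ ^+ 2]mulrC.
    by apply: (@space_lower_boundR _ _ _ (fun _ _ => lam)).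
  by split=> solv; apply: bound; [left|right].
move=> gamma lam gamma_gt0 _ lamC; split=> -[S [softS solv]].
  by apply: (no_semi_streaming gamma_gt0 lamC softS) => n; left.
by apply: (no_semi_streaming gamma_gt0 lamC softS) => n; right.
Qed.
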